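(* Let $G$ be a cubical $\omega$-category with connections and $x\in G_n$. Then $x$ is thin if and only if $x$ is an (iterated) composite, under the compositions $\circ_k$ of $G_n$, of elements of the forms $\varepsilon_iy$ and $\Gamma^\alpha_jz$ for various $i,j,\alpha,y,z$.
   Context: A cubical $\omega$-category with connections $G$ consists of sets $G_n$ ($n\ge0$), face maps $\partial^\alpha_i:G_n\to G_{n-1}$, degeneracies $\varepsilon_i:G_{n-1}\to G_n$, connections $\Gamma^\alpha_i:G_n\to G_{n+1}$ ($1\le i\le n$, $\alpha=\pm$) and partial compositions $\circ_j$ on $G_n$ ($1\le j\le n$, $a\circ_jb$ defined iff $\partial^+_ja=\partial^-_jb$) satisfying: $\partial^\alpha_i\partial^\beta_j=\partial^\beta_{j-1}\partial^\alpha_i$ ($i<j$), $\varepsilon_i\varepsilon_j=\varepsilon_{j+1}\varepsilon_i$ ($i\le j$), $\partial^\alpha_i\varepsilon_j=\varepsilon_{j-1}\partial^\alpha_i$ ($i<j$), $\varepsilon_j\partial^\alpha_{i-1}$ ($i>j$), $\mathrm{id}$ ($i=j$); $\Gamma^\alpha_i\Gamma^\beta_j=\Gamma^\beta_{j+1}\Gamma^\alpha_i$ ($i<j$), $\Gamma^\alpha_i\Gamma^\alpha_i=\Gamma^\alpha_{i+1}\Gamma^\alpha_i$, $\Gamma^\alpha_i\varepsilon_j=\varepsilon_{j+1}\Gamma^\alpha_i$ ($i<j$), $\varepsilon_j\Gamma^\alpha_{i-1}$ ($i>j$), $\Gamma^\alpha_j\varepsilon_j=\varepsilon_{j+1}\varepsilon_j$,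 $\partial^\alpha_i\Gamma^\beta_j=\Gamma^\beta_{j-1}\partial^\alpha_i$ ($i<j$), $\Gamma^\beta_j\partial^\alpha_{i-1}$ ($i>j+1$), $\partial^\alpha_j\Gamma^\alpha_j=\partial^\alpha_{j+1}\Gamma^\alpha_j=\mathrm{id}$, $\partial^\alpha_j\Gamma^{-\alpha}_j=\partial^\alpha_{j+1}\Gamma^{-\alpha}_j=\varepsilon_j\partial^\alpha_j$; $\partial^-_j(a\circ_jb)=\partial^-_ja$, $\partial^+_j(a\circ_jb)=\partial^+_jb$, $\partial^\alpha_i(a\circ_jb)=\partial^\alpha_ia\circ_{j-1}\partial^\alpha_ib$ ($i<j$), $\partial^\alpha_ia\circ_j\partial^\alpha_ib$ ($i>j$); interchange for $i\ne j$; $\varepsilon_i(a\circ_jb)=\varepsilon_ia\circ_{j+1}\varepsilon_ib$ ($i\le j$), $\varepsilon_ia\circ_j\varepsilon_ib$ ($i>j$); $\Gamma^\alpha_i(a\circ_jb)=\Gamma^\alpha_ia\circ_{j+1}\Gamma^\alpha_ib$ ($i<j$), $\Gamma^\alpha_ia\circ_j\Gamma^\alpha_ib$ ($i>j$); $\Gamma^+_j(a\circ_jb)=(\Gamma^+_ja\circ_j\varepsilon_ja)\circ_{j+1}(\varepsilon_{j+1}a\circ_j\Gamma^+_jb)$, $\Gamma^-_j(a\circ_jb)=(\Gamma^-_ja\circ_j\varepsilon_{j+1}b)\circ_{j+1}(\varepsilon_jb\circ_j\Gamma^-_jb)$; each $\circ_j$ is a category structure with identities $\varepsilon_jy$; $\Gamma^+_ix\circ_i\Gamma^-_ix=\varepsilon_{i+1}x$,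 $\Gamma^+_ix\circ_{i+1}\Gamma^-_ix=\varepsilon_ix$. Folding operations on $G_n$: $\psi_ix=\Gamma^+_i\partial^-_{i+1}x\circ_{i+1}x\circ_{i+1}\Gamma^-_i\partial^+_{i+1}x$ ($1\le i\le n-1$), $\Psi_r=\psi_{r-1}\cdots\psi_1$, $\Phi_n=\Psi_1\Psi_2\cdots\Psi_n$. The $\omega$-category $\gamma G$: each $\Phi_n(G_n)$ is a (globular, strict) $\omega$-category with $d^\alpha_px=\varepsilon_1^{n-p}(\partial^\alpha_1)^{n-p}x$, $x\#_py=x\circ_{n-p}y$ for $0\le p<n$, and $d^\alpha_px=x$ with only composites $x\#_px=x$ for $p\ge n$; $\gamma G$ is the colimit of $\Phi_0(G_0)\xrightarrow{\varepsilon_1}\Phi_1(G_1)\xrightarrow{\varepsilon_1}\cdots$. The dimension of an element $u$ of an $\omega$-category is the least $p$ with $d^-_pu=d^+_pu=u$. Thin elements: identifying $x\in G_n$ with the homomorphism $M(I^n)\to\gamma G$ it determines (whose value on the top cell $I^n$ is $\Phi_nx$), $x$ is called thin if $\dim x(I^n)<n$, i.e. if the element $\Phi_nx\in\gamma G$ has dimension less than $n$ in the $\omega$-category $\gamma G$. *)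

(* Defs.v *)
From mathcomp Require Import all_boot.


(* Cubical omega-categories with connections.
   Conventions:
   - C n is the set G_n.
   - face n a i : G_{n+1} -> G_n  is  d^a_i  (1 <= i <= n+1);  a = true is "+", a = false is "-".
   - eps n i : G_n -> G_{n+1}  is  epsilon_i  (1 <= i <= n+1).
   - conn n a i : G_n -> G_{n+1}  is  Gamma^a_i  (1 <= i <= n).
   - comp n j a b : G_{n+1}, is  a o_j b  (1 <= j <= n+1); it is a total function
     whose value is only meaningful (and constrained by the axioms) when
     face n true j a = face n false j b, i.e. when a o_j b is defined.
   Indices outside the stated ranges are unconstrained junk. *)

Record CubOmegaCat := {
  C :> nat -> Type;
  face : forall n, bool -> nat -> C n.+1 -> C n;
  eps : forall n, nat -> C n -> C n.+1;
  conn : forall n, bool -> nat -> C n -> C n.+1;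
  comp : forall n, nat -> C n.+1 -> C n.+1 -> C n.+1;

  ax_face_face : forall n a b i j (x : C n.+2), 1 <= i -> i < j -> j <= n.+2 ->
    face n a i (face n.+1 b j x) = face n b j.-1 (face n.+1 a i x);
  ax_eps_eps : forall n i j (x : C n), 1 <= i -> i <= j -> j <= n.+1 ->
    eps n.+1 i (eps n j x) = eps n.+1 j.+1 (eps n i x);
  ax_face_eps_lt : forall n a i j (x : C n.+1), 1 <= i -> i < j -> j <= n.+2 ->
    face n.+1 a i (eps n.+1 j x) = eps n j.-1 (face n a i x);
  ax_face_eps_gt : forall n a i j (x : C n.+1), 1 <= j -> j < i -> i <= n.+2 ->
    face n.+1 a i (eps n.+1 j x) = eps n j (face n a i.-1 x);
  ax_face_eps_eq : forall n a i (x : C n), 1 <= i -> i <= n.+1 ->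
    face n a i (eps n i x) = x;

  ax_conn_conn_lt : forall n a b i j (x : C n), 1 <= i -> i < j -> j <= n ->
    conn n.+1 a i (conn n b j x) = conn n.+1 b j.+1 (conn n a i x);
  ax_conn_conn_eq : forall n a i (x : C n), 1 <= i -> i <= n ->
    conn n.+1 a i (conn n a i x) = conn n.+1 a i.+1 (conn n a i x);
  ax_conn_eps_lt : forall n a i j (x : C n), 1 <= i -> i < j -> j <= n.+1 ->
    conn n.+1 a i (eps n j x) = eps n.+1 j.+1 (conn n a i x);
  ax_conn_eps_gt : forall n a i j (x : C n), 1 <= j -> j < i -> i <= n.+1 ->
    conn n.+1 a i (eps n j x) = eps n.+1 j (conn n a i.-1 x);
  ax_conn_eps_eq : forall n a j (x : C n), 1 <= j -> j <= n.+1 ->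
    conn n.+1 a j (eps n j x) = eps n.+1 j.+1 (eps n j x);
  ax_face_conn_lt : forall n a b i j (x : C n.+1), 1 <= i -> i < j -> j <= n.+1 ->
    face n.+1 a i (conn n.+1 b j x) = conn n b j.-1 (face n a i x);
  ax_face_conn_gt : forall n a b i j (x : C n.+1), 1 <= j -> j.+1 < i -> i <= n.+2 ->
    face n.+1 a i (conn n.+1 b j x) = conn n b j (face n a i.-1 x);
  ax_face_conn_same1 : forall n a j (x : C n), 1 <= j -> j <= n ->
    face n a j (conn n a j x) = x;
  ax_face_conn_same2 : forall n a j (x : C n), 1 <= j -> j <= n ->
    face n a j.+1 (conn n a j x) = x;
  ax_face_conn_opp1 : forall n a j (x : C n.+1), 1 <= j -> j <= n.+1 ->
    face n.+1 a j (conn n.+1 (~~ a) j x) = eps n j (face n a j x);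
  ax_face_conn_opp2 : forall n a j (x : C n.+1), 1 <= j -> j <= n.+1 ->
    face n.+1 a j.+1 (conn n.+1 (~~ a) j x) = eps n j (face n a j x);

  ax_face_comp_minus : forall n j (x y : C n.+1), 1 <= j -> j <= n.+1 ->
    face n true j x = face n false j y ->
    face n false j (comp n j x y) = face n false j x;
  ax_face_comp_plus : forall n j (x y : C n.+1), 1 <= j -> j <= n.+1 ->
    face n true j x = face n false j y ->
    face n true j (comp n j x y) = face n true j y;
  ax_face_comp_lt : forall n a i j (x y : C n.+2), 1 <= i -> i < j -> j <= n.+2 ->
    face n.+1 true j x = face n.+1 false j y ->
    face n.+1 a i (comp n.+1 j x y) = comp n j.-1 (face n.+1 a i x) (face n.+1 a i y);
  ax_face_comp_gt : forall n a i j (x y : C n.+2), 1 <= j -> j < i -> i <= n.+2 ->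
    face n.+1 true j x = face n.+1 false j y ->
    face n.+1 a i (comp n.+1 j x y) = comp n j (face n.+1 a i x) (face n.+1 a i y);
  ax_interchange : forall n i j (x y z w : C n.+1),
    1 <= i -> i <= n.+1 -> 1 <= j -> j <= n.+1 -> i != j ->
    face n true i x = face n false i y -> face n true i z = face n false i w ->
    face n true j x = face n false j z -> face n true j y = face n false j w ->
    comp n j (comp n i x y) (comp n i z w) = comp n i (comp n j x z) (comp n j y w);
  ax_eps_comp_le : forall n i j (x y : C n.+1), 1 <= i -> i <= j -> j <= n.+1 ->
    face n true j x = face n false j y ->
    eps n.+1 i (comp n j x y) = comp n.+1 j.+1 (eps n.+1 i x) (eps n.+1 i y);
  ax_eps_comp_gt : forall n i j (x y : C n.+1), 1 <= j -> j < i -> i <= n.+2 ->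
    face n true j x = face n false j y ->
    eps n.+1 i (comp n j x y) = comp n.+1 j (eps n.+1 i x) (eps n.+1 i y);
  ax_conn_comp_lt : forall n a i j (x y : C n.+1), 1 <= i -> i < j -> j <= n.+1 ->
    face n true j x = face n false j y ->
    conn n.+1 a i (comp n j x y) = comp n.+1 j.+1 (conn n.+1 a i x) (conn n.+1 a i y);
  ax_conn_comp_gt : forall n a i j (x y : C n.+1), 1 <= j -> j < i -> i <= n.+1 ->
    face n true j x = face n false j y ->
    conn n.+1 a i (comp n j x y) = comp n.+1 j (conn n.+1 a i x) (conn n.+1 a i y);
  ax_conn_comp_plus : forall n j (x y : C n.+1), 1 <= j -> j <= n.+1 ->
    face n true j x = face n false j y ->
    conn n.+1 true j (comp n j x y) =
    comp n.+1 j.+1 (comp n.+1 j (conn n.+1 true j x) (eps n.+1 j x))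
                   (comp n.+1 j (eps n.+1 j.+1 x) (conn n.+1 true j y));
  ax_conn_comp_minus : forall n j (x y : C n.+1), 1 <= j -> j <= n.+1 ->
    face n true j x = face n false j y ->
    conn n.+1 false j (comp n j x y) =
    comp n.+1 j.+1 (comp n.+1 j (conn n.+1 false j x) (eps n.+1 j.+1 y))
                   (comp n.+1 j (eps n.+1 j y) (conn n.+1 false j y));
  ax_comp_assoc : forall n j (x y z : C n.+1), 1 <= j -> j <= n.+1 ->
    face n true j x = face n false j y -> face n true j y = face n false j z ->
    comp n j (comp n j x y) z = comp n j x (comp n j y z);
  ax_comp_idl : forall n j (x : C n.+1), 1 <= j -> j <= n.+1 ->
    comp n j (eps n j (face n false j x)) x = x;
  ax_comp_idr : forall n j (x : C n.+1), 1 <= j -> j <= n.+1 ->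
    comp n j x (eps n j (face n true j x)) = x;
  ax_conn_inv1 : forall n i (x : C n), 1 <= i -> i <= n ->
    comp n i (conn n true i x) (conn n false i x) = eps n i.+1 x;
  ax_conn_inv2 : forall n i (x : C n), 1 <= i -> i <= n ->
    comp n i.+1 (conn n true i x) (conn n false i x) = eps n i x
}.

Set Implicit Arguments.
Unset Strict Implicit.
Unset Printing Implicit Defensive.

Section Folding.
Variable G : CubOmegaCat.

(* psi_i x = Gamma^+_i d^-_{i+1} x  o_{i+1}  x  o_{i+1}  Gamma^-_i d^+_{i+1} x,
   for x in G_{n+1}, 1 <= i <= n  (bracketing irrelevant by associativity). *)
Definition psi (n i : nat) (x : G n.+1) : G n.+1 :=
  comp G n i.+1
    (comp G n i.+1 (conn G n true i (face G n false i.+1 x)) x)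
    (conn G n false i (face G n true i.+1 x)).

(* psi_i on G_m for arbitrary m (identity on G_0, where no psi_i exists). *)
Definition psi' (i m : nat) : G m -> G m :=
  match m return G m -> G m with
  | 0 => fun x => x
  | n.+1 => @psi n i
  end.

Fixpoint Psi (m r : nat) (x : G m) : G m :=
  match r with
  | 0 => x
  | r'.+1 => match r' with
             | 0 => x
             | _ => @psi' r' m (@Psi m r' x)
             end
  end.

Fixpoint PhiAux (m k : nat) (x : G m) : G m :=
  match k with
  | 0 => x
  | k'.+1 => @PhiAux m k' (@Psi m k'.+1 x)
  end.

Definition Phi (n : nat) (x : G n) : G n := @PhiAux n n x.

Fixpoint efd (a : bool) (k : nat) : forall m, G m -> G m :=
  match k with
  | 0 => fun m x => x
  | k'.+1 => fun m =>
      match m return G m -> G m with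
      | 0 => fun x => x
      | m'.+1 => fun x => eps G m' 1 (@efd a k' m' (face G m' a 1 x))
      end
  end.

(* p-source/target in the omega-category Phi_n(G_n):
   d^a_p u = epsilon_1^{n-p} (d^a_1)^{n-p} u for p < n, and d^a_p u = u for p >= n. *)
Definition dcell (n : nat) (a : bool) (p : nat) (u : G n) : G n :=
  if p < n then @efd a (n - p) n u else u.

(* x in G_n is thin iff the element Phi_n x of gamma G has dimension < n,
   i.e. some p < n has d^-_p (Phi_n x) = d^+_p (Phi_n x) = Phi_n x. *)
Definition thin (n : nat) (x : G n) : Prop :=
  exists p, p < n /\ @dcell n false p (@Phi n x) = @Phi n x
                  /\ @dcell n true p (@Phi n x) = @Phi n x.

Inductive degen_conn_composite : forall n, G n -> Prop :=
  | dcc_eps : forall m i (y : G m), 1 <= i -> i <= m.+1 ->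
      degen_conn_composite (eps G m i y)
  | dcc_conn : forall m a j (z : G m), 1 <= j -> j <= m ->
      degen_conn_composite (conn G m a j z)
  | dcc_comp : forall m k (u v : G m.+1), 1 <= k -> k <= m.+1 ->
      face G m true k u = face G m false k v ->
      degen_conn_composite u -> degen_conn_composite v ->
      degen_conn_composite (comp G m k u v).

End Folding.

(* Main.v *)
Require Import Defs.
From mathcomp Require Import all_boot.

(* Each of x and psi_i x is a composite of the other with degeneracies and
   connections of faces of x, so x is a composite of degeneracies and connections as soon as
   Phi_n x is.  Conversely, filter these composites by the largest index k of
   the generators eps_l (l <= k) and Gamma_l (l < k).  Since psi_i of a composite
   is a composite of psi_i-images and of elements eps_i y, applying psi_1, ...,
   psi_(k-1) lowers k by one: psi_i with i < k - 1 only inserts allowed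
   connections, while psi_(k-1) turns eps_k and Gamma_(k-1) into eps_(k-1) and
   every other generator into a composite of generators of the lower level.
   Hence Phi_n takes composites to composites of elements eps_1 y, and these are
   again of the form eps_1 y. *)

Set Implicit Arguments.
Unset Strict Implicit.
Unset Printing Implicit Defensive.

(** * Foldings and arrays in directions i and i+1 *)

Section AdjacentDirections.
Variables (G : CubOmegaCat) (n i : nat).
Hypotheses (i_gt0 : 0 < i) (i_le : i <= n.+1).

Local Notation fc := (face G n.+1).
Local Notation fc' := (face G n).
Local Notation ep := (eps G n.+1).
Local Notation cn := (conn G n.+1).
(** Squares are drawn with direction i+1 to the right and direction i downwards, so [⋅] juxtaposes
    cells and [⊖] stacks them. *)
Local Notation "x ⋅ y" := (Defs.comp G n.+1 i.+1 x y) (at level 40, left associativity).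
Local Notation "x ⊖ y" := (Defs.comp G n.+1 i x y) (at level 45, left associativity).
Local Notation hc x y := (fc true i.+1 x = fc false i.+1 y).
Local Notation vc x y := (fc true i x = fc false i y).

Let i_leS : i <= n.+2. Proof. exact: leqW. Qed.

Lemma face_face_succ a b (x : G n.+2) : fc' a i (fc b i.+1 x) = fc' b i (fc a i x).
Proof. by rewrite ax_face_face. Qed.

Lemma face_succ_eps a (x : G n.+1) : fc a i.+1 (ep i x) = eps G n i (fc' a i x).
Proof. by rewrite ax_face_eps_gt. Qed.

Lemma face_eps_succ a (x : G n.+1) : fc a i (ep i.+1 x) = eps G n i (fc' a i x).
Proof. by rewrite ax_face_eps_lt. Qed.

Lemma face_eps_same a (x : G n.+1) : fc a i (ep i x) = x.
Proof. exact: ax_face_eps_eq. Qed.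

Lemma face_eps_same_succ a (x : G n.+1) : fc a i.+1 (ep i.+1 x) = x.
Proof. exact: ax_face_eps_eq. Qed.

Lemma face_conn a b (x : G n.+1) :
  fc a i (cn b i x) = if a == b then x else eps G n i (fc' a i x).
Proof.
case: eqP => [->|]; first exact: ax_face_conn_same1.
by case: a; case: b => // _; rewrite -(ax_face_conn_opp1 G).
Qed.

Lemma face_succ_conn a b (x : G n.+1) :
  fc a i.+1 (cn b i x) = if a == b then x else eps G n i (fc' a i x).
Proof.
case: eqP => [->|]; first exact: ax_face_conn_same2.
by case: a; case: b => // _; rewrite -(ax_face_conn_opp2 G).
Qed.

Lemma hface0 x y : hc x y -> fc false i.+1 (x ⋅ y) = fc false i.+1 x.
Proof. exact: ax_face_comp_minus. Qed.

Lemma hface1 x y : hc x y -> fc true i.+1 (x ⋅ y) = fc true i.+1 y.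
Proof. exact: ax_face_comp_plus. Qed.

Lemma face_hcomp a x y : hc x y -> fc a i (x ⋅ y) = Defs.comp G n i (fc a i x) (fc a i y).
Proof. by move=> xy; rewrite ax_face_comp_lt. Qed.

Lemma face_vcomp a x y :
  vc x y -> fc a i.+1 (x ⊖ y) = Defs.comp G n i (fc a i.+1 x) (fc a i.+1 y).
Proof. by move=> xy; rewrite ax_face_comp_gt. Qed.

Definition facesE := (face_face_succ, face_succ_eps, face_eps_succ, face_eps_same,
  face_eps_same_succ, face_conn, face_succ_conn).

Lemma hcomp_assoc x y z : hc x y -> hc y z -> x ⋅ y ⋅ z = x ⋅ (y ⋅ z).
Proof. exact: ax_comp_assoc. Qed.

Lemma hcomp_id1 x m : fc false i.+1 x = m -> ep i.+1 m ⋅ x = x.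
Proof. by move<-; exact: ax_comp_idl. Qed.

Lemma hcomp_id2 x m : fc true i.+1 x = m -> x ⋅ ep i.+1 m = x.
Proof. by move<-; exact: ax_comp_idr. Qed.

Lemma vcomp_id1 x m : fc false i x = m -> ep i m ⊖ x = x.
Proof. by move<-; exact: ax_comp_idl. Qed.

Lemma vcomp_id2 x m : fc true i x = m -> x ⊖ ep i m = x.
Proof. by move<-; exact: ax_comp_idr. Qed.

Lemma interchange x y z w : hc x y -> hc z w -> vc x z -> vc y w ->
  (x ⋅ y) ⊖ (z ⋅ w) = (x ⊖ z) ⋅ (y ⊖ w).
Proof. by move=> *; apply: ax_interchange; rewrite ?ltnS // gtn_eqF. Qed.

Lemma vc_hcomp x y z w : hc x y -> hc z w -> vc x z -> vc y w -> vc (x ⋅ y) (z ⋅ w).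
Proof. by move=> xy zw xz yw; rewrite !face_hcomp // xz yw. Qed.

Lemma conn_conn_vcomp m : cn true i m ⊖ cn false i m = ep i.+1 m.
Proof. exact: ax_conn_inv1. Qed.

(** Half foldings, with only one of the two connections attached; [hleft x] is the intermediate
    stage in unfolding [psi i x] back to [x]. *)
Definition hleft x := cn true i (fc false i.+1 x) ⋅ x.
Definition hright x := x ⋅ cn false i (fc true i.+1 x).

Lemma hc_left x : hc (cn true i (fc false i.+1 x)) x.
Proof. by rewrite facesE. Qed.

Lemma hc_right x : hc x (cn false i (fc true i.+1 x)).
Proof. by rewrite facesE. Qed.
Hint Resolve hc_left hc_right : core.

Lemma hface1_left x : fc true i.+1 (hleft x) = fc true i.+1 x.
Proof. exact: hface1. Qed.

Lemma hface0_right x : fc false i.+1 (hright x) = fc false i.+1 x.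
Proof. exact: hface0. Qed.

Lemma psi_left x : psi i x = hleft x ⋅ cn false i (fc true i.+1 x).
Proof. by []. Qed.

Lemma psi_right x : psi i x = cn true i (fc false i.+1 x) ⋅ hright x.
Proof. exact: hcomp_assoc. Qed.

Lemma vface0_left x : fc false i (hleft x) = fc false i x.
Proof. by rewrite face_hcomp // !facesE /= ax_comp_idl. Qed.

Lemma vface1_right x : fc true i (hright x) = fc true i x.
Proof. by rewrite face_hcomp // !facesE /= ax_comp_idr. Qed.

Lemma hface0_psi x : fc false i.+1 (psi i x) = eps G n i (fc' false i (fc false i x)).
Proof. by rewrite psi_right hface0 ?hface0_right ?facesE. Qed.

Lemma hface1_psi x : fc true i.+1 (psi i x) = eps G n i (fc' true i (fc true i x)).
Proof. by rewrite psi_left hface1 ?hface1_left ?facesE. Qed.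

(** Placing Gamma+ of the same face above the right-hand Gamma- of psi_i x turns that column into an
    identity for [⋅]; the degeneracy above the other column changes nothing. *)
Lemma unfold_psi_left x (p := ep i (fc false i x)) (q := cn true i (fc true i.+1 x)) :
  [/\ hc p q, vc (p ⋅ q) (psi i x) & (p ⋅ q) ⊖ psi i x = hleft x].
Proof.
have hc_pq : hc p q by rewrite !facesE.
have vc_p : vc p (hleft x) by rewrite facesE vface0_left.
have vc_q : vc q (cn false i (fc true i.+1 x)) by rewrite !facesE.
have hc_x : hc (hleft x) (cn false i (fc true i.+1 x)) by rewrite hface1_left facesE.
split=> //; first exact: vc_hcomp.
rewrite psi_left interchange // conn_conn_vcomp.
by rewrite vcomp_id1 ?vface0_left // hcomp_id2 // hface1_left.
Qed.

(** The same cancellation on the left: Gamma- is placed below the Gamma+ of [hleft x]. *)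
Lemma unfold_psi_right x (p := cn false i (fc false i.+1 x)) (q := ep i (fc true i x)) :
  [/\ hc p q, vc (hleft x) (p ⋅ q) & hleft x ⊖ (p ⋅ q) = x].
Proof.
have hc_pq : hc p q by rewrite !facesE.
have vc_p : vc (cn true i (fc false i.+1 x)) p by rewrite !facesE.
have vc_q : vc x q by rewrite facesE.
split=> //; first exact: vc_hcomp.
by rewrite interchange // conn_conn_vcomp vcomp_id2 // hcomp_id1.
Qed.

(* With m the common face of x and y, evaluate the array of rows
     p            Gamma+ m   y . Gamma-
     Gamma+ . x   Gamma- m   q
   by columns: the outer columns absorb p and q, and Gamma+ m over Gamma- m is a
   degeneracy. *)
Lemma psi_hcomp x y (p := ep i (fc false i x)) (q := ep i (fc true i y)) : hc x y ->
  [/\ hc p (psi i y), hc (psi i x) q, vc (p ⋅ psi i y) (psi i x ⋅ q)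
    & psi i (x ⋅ y) = (p ⋅ psi i y) ⊖ (psi i x ⋅ q)].
Proof.
rewrite {}/p {}/q => xy.
have xy' a : fc' true i (fc a i x) = fc' false i (fc a i y).
  by rewrite -!face_face_succ xy.
have hc_py : hc (ep i (fc false i x)) (psi i y) by rewrite hface0_psi face_succ_eps xy'.
have hc_xq : hc (psi i x) (ep i (fc true i y)) by rewrite hface1_psi face_succ_eps xy'.
suff [] : vc (ep i (fc false i x) ⋅ psi i y) (psi i x ⋅ ep i (fc true i y)) /\
    psi i (x ⋅ y) = (ep i (fc false i x) ⋅ psi i y) ⊖ (psi i x ⋅ ep i (fc true i y)).
  by [].
have psi_xy : psi i (x ⋅ y) = hleft x ⋅ hright y.
  by rewrite /psi hface0 // hface1 // -hcomp_assoc // [LHS]hcomp_assoc ?hface1_left.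
have sq_m : hc (cn false i (fc true i.+1 x)) (ep i (fc true i y)).
  by rewrite !facesE /= xy'.
have -> : psi i x ⋅ ep i (fc true i y) =
    hleft x ⋅ (cn false i (fc true i.+1 x) ⋅ ep i (fc true i y)).
  by rewrite psi_left hcomp_assoc ?hface1_left ?facesE //= xy'.
rewrite psi_xy (psi_right y).
have sq_x : hc (ep i (fc false i x)) (cn true i (fc false i.+1 y)).
  by rewrite !facesE /= xy'.
have vc_m : vc (cn true i (fc false i.+1 y)) (cn false i (fc true i.+1 x)).
  by rewrite xy !facesE.
have hc_x : hc (hleft x) (cn false i (fc true i.+1 x) ⋅ ep i (fc true i y)).
  by rewrite hface0 // hface1_left; apply: hc_right.
have hc_y : hc (ep i (fc false i x)) (cn true i (fc false i.+1 y) ⋅ hright y).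
  by rewrite hface0 // hface0_right.
have vc_x : vc (ep i (fc false i x)) (hleft x) by rewrite vface0_left facesE.
have vc_q : vc (hright y) (ep i (fc true i y)) by rewrite vface1_right facesE.
have hc_m : hc (cn true i (fc false i.+1 y)) (hright y) by rewrite hface0_right.
have vc_tail : vc (cn true i (fc false i.+1 y) ⋅ hright y)
    (cn false i (fc true i.+1 x) ⋅ ep i (fc true i y)) by exact: vc_hcomp.
split; first exact: vc_hcomp.
rewrite interchange // interchange // vcomp_id1 ?vface0_left // vcomp_id2 ?vface1_right //.
by rewrite xy conn_conn_vcomp hcomp_id1 ?hface0_right.
Qed.

(** The axiom gives a two-by-two array by columns; interchange reads it by rows, and the row
    containing an identity for [⋅] collapses. *)
Lemma conn_plus_comp a b : fc' true i a = fc' false i b ->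
  cn true i (Defs.comp G n i a b) = cn true i a ⊖ (ep i a ⋅ cn true i b).
Proof.
move=> ab; rewrite ax_conn_comp_plus //.
by rewrite -interchange ?facesE /= ?ab // hcomp_id2 ?facesE.
Qed.

Lemma conn_minus_comp a b : fc' true i a = fc' false i b ->
  cn false i (Defs.comp G n i a b) = (cn false i a ⋅ ep i b) ⊖ cn false i b.
Proof.
move=> ab; rewrite ax_conn_comp_minus //.
by rewrite -interchange ?facesE /= ?ab // [X in _ ⊖ X]hcomp_id1 ?facesE.
Qed.

(* The subdivisions of Gamma+ (a o_i a') and Gamma- (b o_i b') have two rows,
   matching those of x o_i y; the interchange law then splits psi_i by rows. *)
Lemma psi_vcomp x y (p := ep i (fc false i.+1 x)) (q := ep i (fc true i.+1 y)) : vc x y ->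
  [/\ hc (psi i x) q, hc p (psi i y), vc (psi i x ⋅ q) (p ⋅ psi i y)
    & psi i (x ⊖ y) = (psi i x ⋅ q) ⊖ (p ⋅ psi i y)].
Proof.
rewrite {}/p {}/q => xy.
have xy' c : fc' true i (fc c i.+1 x) = fc' false i (fc c i.+1 y).
  by rewrite !face_face_succ xy.
have hc_xq : hc (psi i x) (ep i (fc true i.+1 y)).
  by rewrite hface1_psi face_succ_eps face_face_succ xy.
have hc_py : hc (ep i (fc false i.+1 x)) (psi i y).
  by rewrite hface0_psi face_succ_eps face_face_succ xy.
suff [] : vc (psi i x ⋅ ep i (fc true i.+1 y)) (ep i (fc false i.+1 x) ⋅ psi i y) /\
    psi i (x ⊖ y) =
    (psi i x ⋅ ep i (fc true i.+1 y)) ⊖ (ep i (fc false i.+1 x) ⋅ psi i y).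
  by [].
rewrite [psi i (x ⊖ y)]/psi !face_vcomp // conn_plus_comp // conn_minus_comp //.
move: (xy' true) (xy' false); rewrite psi_left psi_right /hleft /hright.
(* The left edges a, a' and right edges b, b' of x and y become variables tied to x and y by
   equations. *)
move: {-1}(fc false i.+1 x) {-1}(fc false i.+1 y) (erefl (fc false i.+1 x))
  (erefl (fc false i.+1 y)) => a a' aE a'E.
move: {-1}(fc true i.+1 x) {-1}(fc true i.+1 y) (erefl (fc true i.+1 x))
  (erefl (fc true i.+1 y)) => b b' bE b'E bb' aa'.
have hc_ax : hc (cn true i a) x by rewrite facesE.
have hc_a'y : hc (cn true i a') y by rewrite facesE.
have hc_xb : hc x (cn false i b) by rewrite facesE.
have hc_yb' : hc y (cn false i b') by rewrite facesE.
have hc_a : hc (ep i a) (cn true i a') by rewrite !facesE /= aa'.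
have hc_b : hc (cn false i b) (ep i b') by rewrite !facesE /= bb'.
have vc_a : vc (cn true i a) (ep i a ⋅ cn true i a').
  by rewrite face_hcomp // !facesE /= -aa' ax_comp_idr.
have vc_b : vc (cn false i b ⋅ ep i b') (cn false i b').
  by rewrite face_hcomp // !facesE /= bb' ax_comp_idl.
have hc_aa'y : hc (ep i a ⋅ cn true i a') y by rewrite hface1.
have hc_xbb' : hc x (cn false i b ⋅ ep i b') by rewrite hface0.
have hc_top : hc (cn true i a ⋅ x) (cn false i b ⋅ ep i b') by rewrite hface1.
have hc_bottom : hc (ep i a ⋅ cn true i a' ⋅ y) (cn false i b') by rewrite hface1.
have vc_head : vc (cn true i a ⋅ x) (ep i a ⋅ cn true i a' ⋅ y) by exact: vc_hcomp.
have -> : cn true i a ⋅ x ⋅ cn false i b ⋅ ep i b' =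
    cn true i a ⋅ x ⋅ (cn false i b ⋅ ep i b').
  by rewrite hcomp_assoc // hface1.
have -> : ep i a ⋅ (cn true i a' ⋅ (y ⋅ cn false i b')) =
    ep i a ⋅ cn true i a' ⋅ y ⋅ cn false i b'.
  by rewrite -!hcomp_assoc ?(hface0 hc_yb').
split; first exact: vc_hcomp.
by rewrite -interchange // -interchange.
Qed.

Lemma psi_eps y : psi i (ep i y) = ep i y.
Proof.
rewrite psi_left !facesE ax_conn_eps_eq // hcomp_id2; last first.
  by rewrite hface1_left facesE.
by rewrite /hleft !facesE ax_conn_eps_eq // hcomp_id1 ?facesE.
Qed.

Lemma psi_eps_succ y : psi i (ep i.+1 y) = ep i y.
Proof.
rewrite psi_left /hleft !facesE hcomp_id2 ?facesE //=.
exact: ax_conn_inv2.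
Qed.

Lemma psi_conn a y : psi i (cn a i y) = ep i y.
Proof.
case: a.
- rewrite psi_left /hleft !facesE /= ax_conn_eps_eq // hcomp_id1 ?facesE //.
  exact: ax_conn_inv2.
- rewrite psi_right /hright !facesE /= ax_conn_eps_eq // hcomp_id2 ?facesE //.
  exact: ax_conn_inv2.
Qed.

(** Unfolding rebuilds a cell from its psi_i and its faces in directions i and i+1, so an equation
    between cells can be checked after folding. *)
Lemma psi_inj x y : (forall a, fc a i x = fc a i y) ->
  (forall a, fc a i.+1 x = fc a i.+1 y) -> psi i x = psi i y -> x = y.
Proof.
move=> xy xyS psi_xy.
have [_ _ <-] := unfold_psi_right x; have [_ _ <-] := unfold_psi_right y.
have [_ _ <-] := unfold_psi_left x; have [_ _ <-] := unfold_psi_left y.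
by rewrite !xy !xyS psi_xy.
Qed.

(** The connections attached by psi_i to a composite in direction j are themselves composites in
    direction j, so two interchanges move psi_i inside. *)
Lemma psi_comp_far j x y : 0 < j <= n.+2 -> (j < i) || (i.+1 < j) ->
  fc true j x = fc false j y ->
  fc true j (psi i x) = fc false j (psi i y) /\
  psi i (Defs.comp G n.+1 j x y) = Defs.comp G n.+1 j (psi i x) (psi i y).
Proof.
move=> /andP[j_gt0 j_le] far xy.
suff [conn_xy conn_comp] : (forall a b,
    fc true j (cn b i (fc a i.+1 x)) = fc false j (cn b i (fc a i.+1 y))) /\
    (forall a b, cn b i (fc a i.+1 (Defs.comp G n.+1 j x y)) =
     Defs.comp G n.+1 j (cn b i (fc a i.+1 x)) (cn b i (fc a i.+1 y))).
  have j_neq : j != i.+1 by apply: contraTneq far => ->; rewrite ltnn ltnNge leqnSn.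
  have hc_l z : hc (cn true i (fc false i.+1 z) ⋅ z) (cn false i (fc true i.+1 z)).
    exact/(etrans (hface1_left z))/hc_right.
  (* For j < i, a face in direction j renumbers direction i+1 as i. *)
  have face_h a p q : hc p q -> fc a j (p ⋅ q) =
      Defs.comp G n (if j < i then i else i.+1) (fc a j p) (fc a j q).
    case: ltnP far => /= [ji _|_ ij] pq; last by rewrite ax_face_comp_gt.
    by rewrite ax_face_comp_lt // ltnW.
  split; first by rewrite /psi !face_h // !conn_xy xy.
  rewrite /psi !conn_comp ax_interchange // ax_interchange //.
  by rewrite !face_h // conn_xy xy.
case/orP: far => [ji|ij].
- have ji' : j < i.+1 by exact: ltnW.
  have fxy a : fc' true j (fc a i.+1 x) = fc' false j (fc a i.+1 y).
    by rewrite !(ax_face_face G n _ a j i.+1) //= xy.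
  split=> a b; first by rewrite !ax_face_conn_lt // fxy.
  by rewrite ax_face_comp_gt // ax_conn_comp_gt.
- case: j j_gt0 j_le ij xy => // j _ j_le ij xy.
  have fxy a : fc' true j (fc a i.+1 x) = fc' false j (fc a i.+1 y).
    by rewrite -!(ax_face_face G n a _ i.+1 j.+1) ?xy.
  split=> a b; first by rewrite !ax_face_conn_gt // fxy.
  by rewrite ax_face_comp_lt // ax_conn_comp_lt.
Qed.

End AdjacentDirections.

(** * Consecutive connections of opposite signs *)

Section MixedConnections.
Variables (G : CubOmegaCat) (n i : nat).
Hypotheses (i_gt0 : 0 < i) (i_le : i <= n.+1).

Let iS_gt0 : 0 < i.+1. Proof. by []. Qed.
Let iS_le : i.+1 <= n.+2. Proof. by []. Qed.
Let i_leS : i <= n.+2. Proof. exact: leqW. Qed.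
Let i_leSS : i <= n.+3. Proof. exact: leqW. Qed.

(* Read Gamma^+ and Gamma^- as substituting the min and the max of two coordinates:
   u(max(x_i, min(x_(i+1), x_(i+2)))) is cut in direction i into
   u(min(max(x_i, x_(i+1)), x_(i+2))) followed by u(max(x_i, x_(i+2))).  The point
   is that Gamma_(i+1) disappears from the right-hand side. *)
Lemma conn_plus_conn_minus (u : G n.+1) :
  conn G n.+2 true i.+1 (conn G n.+1 false i u) =
  Defs.comp G n.+2 i (conn G n.+2 false i (conn G n.+1 true i u))
                     (eps G n.+2 i.+1 (conn G n.+1 false i u)).
Proof.
set A := conn G n.+2 false i _; set B := eps G n.+2 i.+1 _.
have AB : face G n.+2 true i A = face G n.+2 false i B.
  by rewrite (face_eps_succ i_gt0 i_leS) !(face_conn i_gt0) //= (face_conn i_gt0).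
apply: (psi_inj iS_gt0 iS_le).
- move=> a; rewrite face_vcomp // (face_conn iS_gt0 iS_le) (face_succ_conn i_gt0 i_leS).
  rewrite (face_eps_same iS_gt0 iS_le); case: a => /=.
  + by rewrite (face_conn i_gt0) //= vcomp_id1 // (face_conn i_gt0).
  + by rewrite (face_succ_conn i_gt0) //= ax_conn_inv1.
- move=> a; rewrite ax_face_comp_gt // (face_succ_conn iS_gt0 iS_le) /A /B.
  rewrite (ax_face_conn_gt _ _ _ _ i.+2) //= (face_succ_eps iS_gt0 iS_le).
  rewrite !(face_succ_conn i_gt0) //.
  case: a => /=.
  + by rewrite -ax_eps_eps // vcomp_id2 // (face_conn i_gt0).
  + by rewrite ax_conn_eps_eq // -ax_eps_eps // vcomp_id1 // (face_eps_succ i_gt0).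
- have [] := psi_comp_far iS_gt0 iS_le _ _ AB; rewrite ?i_gt0 ?ltnSn // => _ ->.
  rewrite (psi_conn iS_gt0 iS_le) (psi_eps iS_gt0 iS_le).
  (* The left side folds to [B], and [B] is its own fold, so it remains to see that [A] folds to an
     identity for o_i. *)
  suff ->: psi i.+1 A = eps G n.+2 i (eps G n.+1 i u).
    by rewrite vcomp_id1 // (face_eps_succ i_gt0) // (face_conn i_gt0).
  have A0 : face G n.+2 false i.+2 A =
      eps G n.+1 i.+1 (eps G n i (face G n false i u)).
    rewrite /A (ax_face_conn_gt _ _ _ _ i.+2) //= (face_succ_conn i_gt0) //=.
    by rewrite ax_conn_eps_eq.
  have A1 : face G n.+2 true i.+2 A = conn G n.+1 false i u.
    by rewrite /A (ax_face_conn_gt _ _ _ _ i.+2) //= (face_succ_conn i_gt0).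
  rewrite psi_left /hleft A0 ax_conn_eps_eq // hcomp_id1 // A1.
  (* As Gamma-_(i+1) Gamma-_i = Gamma-_i Gamma-_i, what is left is Gamma-_i of Gamma+_i u o_(i+1)
     Gamma-_i u, and the latter is eps_i u. *)
  rewrite -ax_conn_conn_eq // /A -ax_conn_comp_lt ?(face_succ_conn i_gt0) //.
  by rewrite ax_conn_inv2 // ax_conn_eps_eq // -ax_eps_eps.
Qed.

(** Dually, u(min(x_i, max(x_(i+1), x_(i+2)))) is cut in direction i into u(min(x_i, x_(i+2)))
    followed by u(max(min(x_i, x_(i+1)), x_(i+2))). *)
Lemma conn_minus_conn_plus (u : G n.+1) :
  conn G n.+2 false i.+1 (conn G n.+1 true i u) =
  Defs.comp G n.+2 i (eps G n.+2 i.+1 (conn G n.+1 true i u))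
                     (conn G n.+2 true i (conn G n.+1 false i u)).
Proof.
set A := conn G n.+2 true i _; set B := eps G n.+2 i.+1 _.
have BA : face G n.+2 true i B = face G n.+2 false i A.
  by rewrite (face_eps_succ i_gt0 i_leS) !(face_conn i_gt0) //= (face_conn i_gt0).
apply: (psi_inj iS_gt0 iS_le).
- move=> a; rewrite face_vcomp // (face_conn iS_gt0 iS_le) (face_succ_conn i_gt0 i_leS).
  rewrite (face_eps_same iS_gt0 iS_le); case: a => /=.
  + by rewrite (face_succ_conn i_gt0) //= ax_conn_inv1.
  + by rewrite (face_conn i_gt0) //= vcomp_id2 // (face_conn i_gt0).
- move=> a; rewrite ax_face_comp_gt // (face_succ_conn iS_gt0 iS_le) /A /B.
  rewrite (ax_face_conn_gt _ _ _ _ i.+2) //= (face_succ_eps iS_gt0 iS_le).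
  rewrite !(face_succ_conn i_gt0) //.
  case: a => /=.
  + by rewrite ax_conn_eps_eq // -ax_eps_eps // vcomp_id2 // (face_eps_succ i_gt0).
  + by rewrite -ax_eps_eps // vcomp_id1 // (face_conn i_gt0).
- have [] := psi_comp_far iS_gt0 iS_le _ _ BA; rewrite ?i_gt0 ?ltnSn // => _ ->.
  rewrite (psi_conn iS_gt0 iS_le) (psi_eps iS_gt0 iS_le).
  suff ->: psi i.+1 A = eps G n.+2 i (eps G n.+1 i u).
    by rewrite vcomp_id2 // (face_eps_succ i_gt0) // (face_conn i_gt0).
  have A0 : face G n.+2 false i.+2 A = conn G n.+1 true i u.
    by rewrite /A (ax_face_conn_gt _ _ _ _ i.+2) //= (face_succ_conn i_gt0).
  have A1 : face G n.+2 true i.+2 A =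
      eps G n.+1 i.+1 (eps G n i (face G n true i u)).
    rewrite /A (ax_face_conn_gt _ _ _ _ i.+2) //= (face_succ_conn i_gt0) //=.
    by rewrite ax_conn_eps_eq.
  rewrite (psi_right iS_gt0) // /hright A1 ax_conn_eps_eq // hcomp_id2 // A0.
  rewrite -ax_conn_conn_eq // /A -ax_conn_comp_lt ?(face_succ_conn i_gt0) //.
  by rewrite ax_conn_inv2 // ax_conn_eps_eq // -ax_eps_eps.
Qed.

End MixedConnections.

(** * Composites of generators of bounded index *)

Section BoundedComposites.
Variable G : CubOmegaCat.

(** The bound is strict for connections because psi_j sends both Gamma_j and eps_(j+1) to eps_j; at
    k = 1 the only generators left are the eps_1 y. *)
Inductive bounded_composite (k : nat) : forall n, G n -> Prop :=
  | bounded_eps m i (y : G m) : 0 < i <= m.+1 -> i <= k ->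
      bounded_composite k (eps G m i y)
  | bounded_conn m a j (z : G m) : 0 < j <= m -> j < k ->
      bounded_composite k (conn G m a j z)
  | bounded_comp m j (u v : G m.+1) : 0 < j <= m.+1 ->
      face G m true j u = face G m false j v ->
      bounded_composite k u -> bounded_composite k v ->
      bounded_composite k (Defs.comp G m j u v).

Lemma bounded_psi k n i (x : G n.+2) : 0 < i <= n.+1 ->
  (forall a, bounded_composite k (conn G n.+1 a i (face G n.+1 (~~ a) i.+1 x))) ->
  bounded_composite k x -> bounded_composite k (psi i x).
Proof.
move=> /andP[i_gt0 i_le] bnd_conn bnd_x; have bnd_left := bnd_conn true.
have bnd_right := bnd_conn false.
apply: bounded_comp => //; last exact: bounded_comp (hc_left _ _ _) _ _.
by rewrite (hface1_left i_gt0) //; apply: hc_right.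
Qed.

(** These are the connections that psi_k attaches to eps_l. Their index k exceeds the bound, but
    Gamma_k eps_l = eps_l Gamma_(k-1) for l < k, and Gamma_k eps_k = eps_k eps_k. *)
Lemma bounded_conn_eps n a k l (y : G n) : 0 < l <= k -> k <= n.+1 ->
  bounded_composite k (conn G n.+1 a k (eps G n l y)).
Proof.
move=> /andP[l_gt0 le_lk] k_le; have k_gt0 := leq_trans l_gt0 le_lk.
move: le_lk; rewrite leq_eqVlt => /orP[/eqP-> | lt_lk].
  by rewrite ax_conn_eps_eq // -ax_eps_eps //; apply: bounded_eps; rewrite ?k_gt0 // ltnW.
rewrite ax_conn_eps_gt //; apply: bounded_eps; last exact: ltnW.
by rewrite l_gt0 ltnW // (leq_trans lt_lk) // ltnW.
Qed.

(** The outer index k is again too large. It drops by commutation if l < k-1, and by Gamma_k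
    Gamma_(k-1) = Gamma_(k-1) Gamma_(k-1) for l = k-1 and equal signs; opposite signs need the
    exchange formulas for mixed connections. *)
Lemma bounded_conn_conn n a b k l (y : G n) : 0 < l < k -> k <= n.+1 ->
  bounded_composite k (conn G n.+1 a k (conn G n b l y)).
Proof.
case: k => [|k] /andP[l_gt0] //; rewrite ltnS => le_lk k_le.
have k_gt0 := leq_trans l_gt0 le_lk.
move: le_lk; rewrite leq_eqVlt => /orP[/eqP-> | lt_lk]; last first.
  rewrite -ax_conn_conn_lt //; apply: bounded_conn; last exact: leqW.
  by rewrite l_gt0 ltnW // (leq_trans lt_lk) // ltnW.
case: n y k_le => [|n] y k_le; first by case: k k_gt0 k_le.
have bnd m c (z : G m) : k <= m -> bounded_composite k.+1 (conn G m c k z).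
  by move=> k_m; apply: bounded_conn; rewrite ?k_gt0.
have bndE m (z : G m) : k <= m -> bounded_composite k.+1 (eps G m k.+1 z).
  by move=> k_m; apply: bounded_eps.
have [-> | neq_ab] := eqVneq a b.
  by rewrite -ax_conn_conn_eq //; apply: bnd; rewrite leqW.
have k_le1 : k <= n.+1 by [].
have [k_le2 k_le3] : k <= n.+2 /\ 0 < k <= n.+3 by rewrite k_gt0 !(leq_trans k_le1) // leqW.
case: a b neq_ab => [] [] // _.
- rewrite conn_plus_conn_minus //; apply: bounded_comp; auto.
  by rewrite (face_eps_succ k_gt0) // !(face_conn k_gt0) //= (face_conn k_gt0).
- rewrite conn_minus_conn_plus //; apply: bounded_comp; auto.
  by rewrite (face_eps_succ k_gt0) // !(face_conn k_gt0) //= (face_conn k_gt0).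
Qed.

Lemma psi_lowers_bound k n (x : G n) : 0 < k < n -> bounded_composite k.+1 x ->
  bounded_composite k (psi' k x).
Proof.
move=> /andP[k_gt0] lt_kn bnd_x; elim: n x / bnd_x lt_kn => [m l y|m a l y|m l u v].
- case: m y => [|m] y; first by case: k k_gt0.
  move=> /andP[l_gt0 _] + k_le; have k_range : 0 < k <= m.+1 by rewrite k_gt0.
  rewrite [l <= _]leq_eqVlt => /orP[/eqP->|lt_lk] /=.
    rewrite psi_eps_succ //; apply: bounded_eps; rewrite ?k_gt0 //; exact: leqW.
  apply: bounded_psi => // [a|].
    by rewrite ax_face_eps_gt //; apply: bounded_conn_eps; rewrite ?l_gt0.
  by apply: bounded_eps => //; rewrite l_gt0 (leq_trans (lt_lk : l <= k)) // ltnW.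
- case: m y => [|m] y; first by case: k k_gt0.
  move=> /andP[l_gt0 _] + k_le; have k_range : 0 < k <= m.+1 by rewrite k_gt0.
  rewrite [l < _]leq_eqVlt eqSS => /orP[/eqP->|lt_lk] /=.
    rewrite psi_conn //; apply: bounded_eps; rewrite ?k_gt0 //; exact: leqW.
  apply: bounded_psi => // [b|].
    by rewrite ax_face_conn_gt //; apply: bounded_conn_conn; rewrite ?l_gt0.
  by apply: bounded_conn => //; rewrite l_gt0 ltnW // (leq_trans (lt_lk : l < k)).
- move=> l_range uv _ bnd_u _ bnd_v lt_km; move: (bnd_u lt_km) (bnd_v lt_km) => {}bnd_u {}bnd_v.
  case: m u v lt_km uv bnd_u bnd_v l_range => [|m] u v; first by case: k k_gt0.
  rewrite ltnS /= => k_le uv bnd_u bnd_v l_range.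
  have k_range : 0 < k <= m.+2 by rewrite k_gt0 leqW.
  (* In the arrays for o_k and o_(k+1), every cell besides the two folds is a degeneracy of index
     k. *)
  have bnd_eps y : bounded_composite k (eps G m.+1 k y) by exact: bounded_eps.
  have far : (l < k) || (k.+1 < l) -> bounded_composite k (psi k (Defs.comp G m.+1 l u v)).
    move=> lk; have [comp_uv ->] := psi_comp_far k_gt0 k_le l_range lk uv.
    exact: bounded_comp.
  have [lk | | l_eq] := ltngtP l k; first by apply: far; rewrite lk.
  + rewrite leq_eqVlt => /orP[/eqP kl | lk]; last by apply: far; rewrite lk orbT.
    subst l; have [? ? ? ->] := psi_hcomp k_gt0 k_le uv.
    by do !apply: bounded_comp => //.
  + subst l; have [? ? ? ->] := psi_vcomp k_gt0 k_le uv.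
    by do !apply: bounded_comp => //.
Qed.

Lemma bounded_psi' k n i (x : G n) : 0 < i < k -> i < n ->
  bounded_composite k x -> bounded_composite k (psi' i x).
Proof.
case/andP=> i_gt0 lt_ik; case: n x => [|[|n]] x //= i_lt bnd_x; first by case: i i_gt0 i_lt lt_ik.
by apply: bounded_psi => // [|a]; [| apply: bounded_conn]; rewrite ?i_gt0.
Qed.

Lemma bounded_Psi k n r (x : G n) : r <= k <= n ->
  bounded_composite k x -> bounded_composite k (Psi r x).
Proof.
move=> /andP[le_rk le_kn] bnd_x; elim: r le_rk => //= -[|r] // IHr lt_rk.
by apply: bounded_psi' => //; [exact: leq_trans le_kn | apply: IHr; exact: ltnW].
Qed.

(** Psi_k is psi_(k-1) after Psi_(k-1): the latter keeps the bound k and psi_(k-1) lowers it, so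
    each factor of Phi gains one level. *)
Lemma bounded_PhiAux k n (x : G n) : 0 < k <= n ->
  bounded_composite k x -> bounded_composite 1 (PhiAux k x).
Proof.
elim: k x => // -[|k] IHk x // /andP[_ lt_kn] bnd_x.
apply: IHk; first exact: ltnW.
apply: psi_lowers_bound => //; apply: (@bounded_Psi _ _ k.+1) => //.
by rewrite leqnSn.
Qed.

(** Elements eps_1 y are closed under composition: o_1 composes equal identities, and the other
    compositions commute with eps_1. Dimension 0 contains no generators or composites, hence
    [False]. *)
Lemma bounded1_eps n (x : G n) : bounded_composite 1 x ->
  match n return G n -> Prop with
  | 0 => fun _ => False
  | m.+1 => fun x => exists y, x = eps G m 1 y
  end x.
Proof.
elim=> {n x} [m i y /andP[] | m a j z /andP[] | m j u v j_range uv _ [a u_a] _ [b v_b]].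
- by case: i => [|[]] // _ _ _; exists y.
- by case: j.
rewrite {}u_a {}v_b in uv *.
case: j j_range uv => [|[|j]] // /andP[_ j_le].
  rewrite !ax_face_eps_eq // => <-; exists a.
  by rewrite -[X in Defs.comp _ _ _ _ (eps _ _ _ X)](ax_face_eps_eq G m true 1) // ax_comp_idr.
case: m u v a b j_le => // m _ _ a b j_le; rewrite !ax_face_eps_gt //= => ab.
(* eps_1 is injective, since a face in direction 1 undoes it. *)
have {}ab : face G m true j.+1 a = face G m false j.+1 b.
  by rewrite -(ax_face_eps_eq G m true 1 (face _ _ _ _ a)) // ab ax_face_eps_eq.
by exists (Defs.comp G m j.+1 a b); rewrite ax_eps_comp_le.
Qed.

Lemma degen_conn_composite_bounded k n (x : G n) : n <= k ->
  degen_conn_composite x -> bounded_composite k x.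
Proof.
move=> + dcc_x; elim: n x / dcc_x => [m i y i_gt0 i_le | m a j z j_gt0 j_le |
  m j u v j_gt0 j_le uv _ IHu _ IHv] le_mk.
- by apply: bounded_eps; [rewrite i_gt0 | exact: leq_trans i_le le_mk].
- by apply: bounded_conn; [rewrite j_gt0 | exact: leq_ltn_trans j_le le_mk].
- apply: bounded_comp => //; [by rewrite j_gt0 | exact: IHu | exact: IHv].
Qed.

(** * Recovering x from its foldings *)

Lemma degen_conn_composite_of_psi n i (x : G n) : 0 < i < n ->
  degen_conn_composite (psi' i x) -> degen_conn_composite x.
Proof.
case: n x => [|[|n]] x /andP[i_gt0 i_le] //=; first by case: i i_gt0 i_le.
have i_leS : i <= n.+2 by exact: ltnW.
have dcc_ep y : degen_conn_composite (eps G n.+1 i y) by exact: dcc_eps.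
have dcc_cn a y : degen_conn_composite (conn G n.+1 a i y) by exact: dcc_conn.
move=> dcc_psi; have [hc1 vc1 xE] := unfold_psi_left i_gt0 i_le x.
have [hc2 vc2 <-] := unfold_psi_right i_gt0 i_le x.
by rewrite -xE in vc2 *; do !apply: dcc_comp => //.
Qed.

Lemma degen_conn_composite_of_Psi r n (x : G n) : r <= n ->
  degen_conn_composite (Psi r x) -> degen_conn_composite x.
Proof.
elim: r => //= -[|r] // IHr lt_rn /degen_conn_composite_of_psi dcc.
by apply: IHr; [exact: ltnW | exact: dcc].
Qed.

Lemma degen_conn_composite_of_PhiAux k n (x : G n) : k <= n ->
  degen_conn_composite (PhiAux k x) -> degen_conn_composite x.
Proof.
elim: k x => //= k IHk x lt_kn /(IHk _ (ltnW lt_kn)).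
exact: (@degen_conn_composite_of_Psi k.+1).
Qed.

(** For p below the dimension, d_p u is by construction some eps_1 z. Conversely eps_1 y is fixed by
    both eps_1 d_1, so p can be one less than the dimension. *)
Lemma thinP n (x : G n.+1) : thin x <-> exists y, Phi x = eps G n 1 y.
Proof.
split=> [[p [lt_pn [<- _]]] | [y xE]].
  rewrite /dcell lt_pn subSn //=; eexists; reflexivity.
exists n; rewrite ltnSn /dcell ltnSn subSn // subnn /= xE.
by rewrite !ax_face_eps_eq.
Qed.

End BoundedComposites.

Theorem theorem9p3 (G : CubOmegaCat) (n : nat) (x : G n) :
  thin x <-> degen_conn_composite x.
Proof.
case: n x => [|n] x.
  (* In dimension 0 both sides are false: no p lies below 0, and G_0 contains no generators or
     composites. *)
  by split=> [[p []] // | /(degen_conn_composite_bounded (leq0n 1))/bounded1_eps].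
split=> [/thinP[y xE] | dcc_x]; last first.
  apply/thinP/(bounded1_eps (x := Phi x))/(bounded_PhiAux (k := n.+1)).
    exact: leqnn.
  exact: degen_conn_composite_bounded.
apply: (@degen_conn_composite_of_PhiAux _ n.+1) => //.
by rewrite -/(Phi x) xE; apply: dcc_eps.
Qed.
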